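(* Let $T=[0,1]^2$ and, for $0<\alpha<1$, let $G(\alpha)=[\tfrac12-\tfrac{\alpha}{2},\tfrac12+\tfrac{\alpha}{2}]^2$. Then $\inf\{\alpha: G(\alpha)\text{ intersects every nontrivial billiard path in }T\}=\frac13.$
   Context: A billiard path in the unit square $T=[0,1]^2$ starts at the corner $(0,0)$ with initial direction $(\cos\phi,\sin\phi)$, $0\le\phi\le\pi/2$, and reflects specularly off the sides. Formally, it is the image of the ray $\{t(\cos\phi,\sin\phi): t\ge0\}$ under the folding map $F:\mathbb{R}^2\to T$, $F(x,y)=(f(x),f(y))$, where $f(u)$ is the distance from $u$ to the nearest even integer (so that unfolding the path by reflecting the table across its sides yields the straight ray). The path is nontrivial if $0<\phi<\pi/2$. *)

(* Defs.v *)
From mathcomp Require Import all_boot all_order all_algebra.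
From mathcomp Require Import all_classical all_reals all_analysis.

Set Implicit Arguments.
Unset Strict Implicit.
Unset Printing Implicit Defensive.

Import Order.TTheory GRing.Theory Num.Theory.

Local Open Scope classical_set_scope.
Local Open Scope ring_scope.

(* The distance from u to the set of even integers; the infimum is attained
   at the nearest one. *)
Definition dist_even (R : realType) (u : R) : R :=
  inf [set `|u - (2 * k)%:~R| | k in [set: int]].

(* Folds the plane onto the table [0, 1]^2. *)
Definition folding (R : realType) (p : R * R) : R * R :=
  (dist_even p.1, dist_even p.2).

Definition ray (R : realType) (phi : R) : set (R * R) :=
  [set (t * cos phi, t * sin phi) | t in [set t : R | 0 <= t]].

(* The trajectory leaving the corner (0, 0) at angle phi, as a subset of the
   table. *)
Definition billiard_path (R : realType) (phi : R) : set (R * R) :=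
  @folding R @` ray phi.

Definition central_square (R : realType) (alpha : R) : set (R * R) :=
  `[1 / 2 - alpha / 2, 1 / 2 + alpha / 2] `*`
  `[1 / 2 - alpha / 2, 1 / 2 + alpha / 2].

Definition meets_all_nontrivial_paths (R : realType) (A : set (R * R)) : Prop :=
  forall phi : R, 0 < phi < pi / 2 -> A `&` billiard_path phi !=set0.

(* Main.v *)
(* The folded coordinate of u lies within 1/6 of 1/2 exactly when u is at
   distance at least 1/3 from the integers, so the upper bound is the lonely
   runner problem for two speeds c <= s.  If s < 2c, the time at which the slow
   coordinate is 1/3 works; otherwise, while the slow coordinate runs through
   [1/3, 2/3], the fast one runs through an interval of length at least 2/3,
   which cannot stay within distance 1/3 of an integer.  The direction of slope
   2 shows that 1/3 is optimal. *)
Require Import Defs.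
From mathcomp Require Import all_boot all_order all_algebra.
From mathcomp Require Import all_classical all_reals all_analysis.
From mathcomp Require Import ring lra zify.

Import Order.TTheory GRing.Theory Num.Theory.

Local Open Scope classical_set_scope.
Local Open Scope ring_scope.

(** Distinct even integers are at least 2 apart, so by the triangle inequality one within 1 of [u]
    is a nearest one. *)
Lemma dist_even_near (R : realType) (u : R) (j : int) :
  `|u - (2 * j)%:~R| <= 1 -> dist_even u = `|u - (2 * j)%:~R|.
Proof.
move=> uj; apply/eqP; rewrite eq_le; apply/andP; split.
  by apply: ge_inf; [exists 0 => _ [k _ <-]; exact: normr_ge0 | exists j].
apply: lb_le_inf; first by exists `|u - (2 * j)%:~R|, j.
move=> _ [k _ <-]; have [->//|kj] := eqVneq k j.
have : 2 <= `|(2 * j)%:~R - (2 * k)%:~R : R|.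
  by rewrite -intrB -intr_norm (ler_int _ 2); lia.
have := ler_distD u (2 * j)%:~R ((2 * k)%:~R : R).
rewrite (distrC _ u); lra.
Qed.

Lemma near_even (R : realType) (u : R) : exists j : int, `|u - (2 * j)%:~R| <= 1.
Proof.
(* Rounding [u / 2] to a nearest integer [j] gives [2j - 1 <= u < 2j + 1]. *)
exists (Num.floor ((u + 1) / 2)).
have := floor_itv ((u + 1) / 2); rewrite intrM intrD => /andP[? ?].
rewrite ler_norml; lra.
Qed.

(** On [[k, k + 1]] the folding is [u - k] for even [k] and [1 - (u - k)] for odd [k]; both preserve
    the middle third. *)
Lemma dist_even_middle (R : realType) (u : R) (k : int) :
  k%:~R + 1 / 3 <= u <= k%:~R + 2 / 3 -> 1 / 3 <= dist_even u <= 2 / 3.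
Proof.
have [j [->|->]] : exists j : int, k = 2 * j \/ k = 2 * j - 1.
- have [kE|kE] : (k %% 2)%Z = 0 \/ (k %% 2)%Z = 1 by lia.
    by exists (k %/ 2)%Z; left; lia.
  by exists ((k %/ 2)%Z + 1); right; lia.
- move=> /andP[? ?]; have uj : `|u - (2 * j)%:~R| = u - (2 * j)%:~R.
    by rewrite ger0_norm; lra.
  by rewrite (@dist_even_near _ _ j) uj; lra.
- rewrite intrB => /andP[? ?].
  have uj : `|u - (2 * j)%:~R| = (2 * j)%:~R - u.
    by rewrite distrC ger0_norm; lra.
  by rewrite (@dist_even_near _ _ j) uj; lra.
Qed.

(** Consecutive middle thirds [[k + 1/3, k + 2/3]] are separated by gaps of length exactly 2/3. *)
Lemma middle_in_interval (R : realType) (a b : R) : a + 2 / 3 <= b ->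
  exists2 y, a <= y <= b & 1 / 3 <= dist_even y <= 2 / 3.
Proof.
move=> ab; have := floor_itv a; set k := Num.floor a.
rewrite intrD => /andP[ka ak].
have [a1|a1] := leP a (k%:~R + 1 / 3).
  by exists (k%:~R + 1 / 3); [lra | apply: (@dist_even_middle _ _ k); lra].
have [a2|a2] := leP a (k%:~R + 2 / 3).
  by exists a; [lra | apply: (@dist_even_middle _ _ k); lra].
exists (k%:~R + 4 / 3); first lra.
by apply: (@dist_even_middle _ _ (k + 1)); rewrite intrD; lra.
Qed.

Lemma two_lonely_runners (R : realType) (c s : R) : 0 < c -> 0 < s ->
  exists2 t, 0 <= t &
    1 / 3 <= dist_even (t * c) <= 2 / 3 /\ 1 / 3 <= dist_even (t * s) <= 2 / 3.
Proof.
wlog cs : c s / c <= s.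
  move=> H c0 s0; have [cs|/ltW sc] := leP c s; first exact: H.
  by have [t t0 [? ?]] := H _ _ sc s0 c0; exists t.
move=> c0 s0; have mid0 (u : R) : 1 / 3 <= u <= 2 / 3 ->
    1 / 3 <= dist_even u <= 2 / 3.
  by move=> u12; apply: (@dist_even_middle _ _ 0); lra.
have [s2|s2] := leP s (2 * c).
  exists (3 * c)^-1; first by rewrite invr_ge0; lra.
  have -> : (3 * c)^-1 * c = 1 / 3 by field; rewrite gt_eqF.
  split; apply: mid0; first lra.
  rewrite (mulrC _ s) ler_pdivlMr ?ler_pdivrMr; lra.
(* The bounds are the values of [t * s] when [t * c] is 1/3 and 2/3; their difference [s / (3 * c)]
   exceeds 2/3. *)
have [y /andP[y1 y2] ymid] : exists2 y, s / (3 * c) <= y <= 2 * s / (3 * c) &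
    1 / 3 <= dist_even y <= 2 / 3.
  apply: middle_in_interval.
  have -> : 2 * s / (3 * c) = s / (3 * c) + s / (3 * c).
    by field; rewrite gt_eqF.
  by rewrite lerD2l ler_pdivlMr; lra.
have {}y1 : s <= y * (3 * c) by rewrite -ler_pdivrMr //; lra.
have {}y2 : y * (3 * c) <= 2 * s by rewrite -ler_pdivlMr //; lra.
have y0 : 0 <= y by nra.
exists (y / s); first by rewrite divr_ge0 // ltW.
split; last by rewrite divfK ?gt_eqF.
apply: mid0; rewrite mulrAC ler_pdivlMr // ler_pdivrMr //; lra.
Qed.

(** Folding turns doubling into the tent map: with [v = dist_even u], [dist_even (2 * u)] is the
    smaller of [2v] and [2 - 2v]. *)
Lemma dist_even_double (R : realType) (u : R) :
  1 / 3 < dist_even u < 2 / 3 -> 2 / 3 < dist_even (2 * u).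
Proof.
have [j uj] := near_even _ u; rewrite (dist_even_near _ _ _ uj).
have -> : u = u - (2 * j)%:~R + (2 * j)%:~R by rewrite subrK.
move: (u - _) => w; rewrite addrK => /andP[w1 w2].
(* Shifting by the even integer [4j] reduces to [2 * w], whose nearest even integer is 0, 2 or
   -2. *)
have near2 (i : int) : 2 / 3 < `|2 * w - (2 * i)%:~R| <= 1 ->
    2 / 3 < dist_even (2 * (w + (2 * j)%:~R)).
  have -> : 2 * w - (2 * i)%:~R
      = 2 * (w + (2 * j)%:~R) - (2 * (2 * j + i))%:~R.
    by rewrite !(intrM, intrD); ring.
  by move=> /andP[? ?]; rewrite (@dist_even_near _ _ (2 * j + i)).
have [w0|w0] := leP 0 w; move: w1 w2.
  rewrite ger0_norm // => w1 w2; have [wle|wgt] := leP (2 * w) 1.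
    by apply: (near2 0); rewrite mulr0 subr0 ger0_norm; lra.
  by apply: (near2 1); rewrite mulr1 distrC ger0_norm; lra.
rewrite ltr0_norm // => w1 w2; have [wle|wgt] := leP (-1) (2 * w).
  by apply: (near2 0); rewrite mulr0 subr0 ler0_norm; lra.
by apply: (near2 (-1)); rewrite mulrN1 intrN opprK ger0_norm; lra.
Qed.

Theorem theorem24 (R : realType) :
  inf [set alpha : R | 0 < alpha < 1 /\
         meets_all_nontrivial_paths (central_square alpha)] = 1 / 3.
Proof.
set A := [set alpha | _].
have A3 : A (1 / 3).
  split; first lra.
  move=> phi phi0; have c0 : 0 < cos phi by apply: cos_gt0_pihalf; lra.
  have s0 : 0 < sin phi by apply: sin_gt0_pihalf.
  have [t t0 [tc ts]] := two_lonely_runners _ _ _ c0 s0.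
  exists (folding (t * cos phi, t * sin phi)); split.
    by split; rewrite /= in_itv /=; lra.
  by exists (t * cos phi, t * sin phi) => //; exists t.
have lbA : lbound A (1 / 3).
  move=> alpha [alpha0 meets]; rewrite leNgt; apply/negP => alpha3.
  (* On the path of slope 2 the unfolded points are [(x, 2x)]; a square with [alpha < 1/3] would put
     the foldings of both [x] and [2x] strictly below 2/3, and that of [x] above 1/3. *)
  have phi0 : 0 < atan (2 : R) < pi / 2.
    by rewrite atan_ltpi2 -[X in X < _](atan0 R) lt_atan.
  have [p [Gp [_ [t _ <-] pE]]] := meets _ phi0.
  have sinE : sin (atan 2) = 2 * cos (atan 2) :> R.
    have c0 : 0 < cos (atan (2 : R)) by apply: cos_gt0_pihalf; lra.
    by rewrite -{2}[2](atanK 2) /tan divfK ?gt_eqF.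
  move: Gp; rewrite -pE => -[/=]; rewrite !in_itv /= sinE mulrCA => /andP[c1 c2] /andP[_ s2].
  have : 1 / 3 < dist_even (t * cos (atan 2)) < 2 / 3 by lra.
  by move/dist_even_double; lra.
apply/eqP; rewrite eq_le; apply/andP; split.
  by apply: ge_inf => //; exists (1 / 3).
by apply: lb_le_inf => //; exists (1 / 3).
Qed.
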